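(* Let $n$ be a positive integer and let $N=3(n+1)$. Define integers $a_j$ ($j\ge 0$) by $$\prod_{i=0}^{n}(1-q^{3i+1})(1-q^{3i+2})=\sum_{j\ge 0}a_j q^j .$$ Then for every integer $j$ with $0\le j\le N$ and $j\equiv 0 \pmod 3$, $$a_j+a_{N+j}+a_{2N+j}+\cdots+a_{nN+j}>0 .$$
   Context: The $a_j$ are the coefficients of the polynomial expansion of the finite product; $a_j=0$ for $j$ larger than the degree $3(n+1)^2$ of the product. *)

(* Defs.v *)
From mathcomp Require Import all_boot all_order all_algebra.

Set Implicit Arguments.
Unset Strict Implicit.
Unset Printing Implicit Defensive.

Import Order.TTheory GRing.Theory Num.Theory.
Local Open Scope ring_scope.

Definition borwein_prod (n : nat) : {poly int} :=
  \prod_(0 <= i < n.+1) ((1 - 'X^(3 * i + 1)) * (1 - 'X^(3 * i + 2))).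

(* Zero beyond the degree, since [p`_j] is [nth 0 p j]. *)
Definition borwein_coef (n j : nat) : int := (borwein_prod n)`_j.

(* Main.v *)
(** Up to boundary terms, the sum is the sum of the coefficients of the product [P] over a residue
    class modulo [N = 3 M], [M = n.+1], so [N] times it is the sum of [w^(-j) P(w)] over the [N]-th
    roots of unity [w].  If [w ^+ 3] has order [e], then [P(w)] is [0] or [3 ^ (M / e)].  The two
    primitive cube roots of unity give [3 ^ M] each, and every root outside the cube roots of unity
    contributes at most [3 ^ (M / 2)] in absolute value, which is too small to cancel them. *)
Require Import Defs.
From mathcomp Require Import all_boot all_order all_algebra all_field.
From mathcomp Require Import zify ring.

Set Implicit Arguments.
Unset Strict Implicit.
Unset Printing Implicit Defensive.

Import Order.TTheory GRing.Theory Num.Theory.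
Local Open Scope ring_scope.

(** Evaluate the factorization of ['X^e - 1] into the ['X - u ^+ i] at [c^-1], then multiply by
    [c ^+ e]. *)
Lemma prod_one_sub_prim_root (F : fieldType) (e : nat) (u c : F) :
  e.-primitive_root u -> c != 0 ->
  \prod_(0 <= i < e) (1 - u ^+ i * c) = 1 - c ^+ e.
Proof.
move=> u_prim c0.
have /(congr1 (fun p => c ^+ e * p.[c^-1])) := factor_Xn_sub_1 u_prim.
rewrite !hornerE horner_prod mulrBr mulr1 -exprMn divff // expr1n => <-.
rewrite -{2}[e]subn0 -prodr_const_nat -big_split /=; apply: eq_bigr => i _.
by rewrite !hornerE mulrBr divff // mulrC.
Qed.

Lemma prod_periodic (R : comNzRingType) (f e : nat) (F : nat -> R) :
  (forall i, F (e + i)%N = F i) ->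
  \prod_(0 <= i < f * e) F i = (\prod_(0 <= i < e) F i) ^+ f.
Proof.
move=> Fper; have Fmul k i : F (k * e + i)%N = F i.
  by elim: k => [|k IHk]; rewrite ?mul0n ?add0n // mulSn -addnA Fper.
rewrite big_nat_mul -{2}[f]subn0 -prodr_const_nat; apply: eq_bigr => k _.
rewrite -{1}[(k * e)%N]add0n big_addn mulSn addnK.
by apply: eq_bigr => i _; rewrite addnC Fmul.
Qed.

(** Since [w ^+ (3 * e) = 1], the factors have period [e] in [i]. Over one period the two families
    multiply up by [prod_one_sub_prim_root], with [c = w] and [c = w ^+ 2]. *)
Lemma borwein_values (F : fieldType) (f e : nat) (w : F) :
  e.-primitive_root (w ^+ 3) ->
  \prod_(0 <= i < f * e) ((1 - w ^+ (3 * i + 1)) * (1 - w ^+ (3 * i + 2)))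
    = ((1 - w ^+ e) * (1 - (w ^+ e) ^+ 2)) ^+ f.
Proof.
move=> w3_prim; have w3e : w ^+ (3 * e) = 1
  by rewrite exprM (prim_expr_order w3_prim).
have e_gt0 := prim_order_gt0 w3_prim.
have w0 : w != 0.
  apply/eqP => w0; move/eqP: w3e.
  by rewrite w0 expr0n muln_eq0 (gtn_eqF e_gt0) /= eq_sym oner_eq0.
rewrite prod_periodic => [|i]; last first.
  by rewrite mulnDr -2!(addnA (3 * e)%N) 2!(exprD _ (3 * e)%N) w3e !mul1r.
congr (_ ^+ f); rewrite big_split -exprM mulnC exprM /=; congr (_ * _).
  rewrite -(prod_one_sub_prim_root w3_prim w0); apply: eq_bigr => i _.
  by rewrite exprD exprM expr1.
rewrite -(prod_one_sub_prim_root w3_prim (expf_neq0 2 w0)).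
by apply: eq_bigr => i _; rewrite exprD exprM.
Qed.

Lemma cube_root_value (F : fieldType) (x : F) :
  x ^+ 3 = 1 -> (1 - x) * (1 - x ^+ 2) = if x == 1 then 0 else 3.
Proof.
move=> x3; case: eqP => [->|/eqP x1]; first by rewrite subrr mul0r.
have : (x - 1) * (1 + x + x ^+ 2) = 0.
  have -> : (x - 1) * (1 + x + x ^+ 2) = x ^+ 3 - 1 by ring.
  by rewrite x3 subrr.
move/eqP; rewrite mulf_eq0 subr_eq0 (negPf x1) /= => /eqP s0.
have -> : (1 - x) * (1 - x ^+ 2) = 2 + x ^+ 3 - (1 + x + x ^+ 2) by ring.
by rewrite s0 x3; ring.
Qed.

Lemma sum_prim_root_pow (F : fieldType) (N m : nat) (z : F) :
  N.-primitive_root z ->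
  \sum_(0 <= k < N) z ^+ (k * m) = if (N %| m)%N then N%:R else 0.
Proof.
move=> z_prim; have -> : \sum_(0 <= k < N) z ^+ (k * m)
    = \sum_(0 <= k < N) (z ^+ m) ^+ k.
  by apply: eq_bigr => k _; rewrite mulnC exprM.
rewrite (prim_order_dvd z_prim); case: eqP => [->|/eqP zm].
  under eq_bigr do rewrite expr1n.
  by rewrite sumr_const_nat subn0.
apply/eqP; rewrite -(mulrI_eq0 _ (mulfI (_ : z ^+ m - 1 != 0))) ?subr_eq0 //.
by rewrite big_mkord -subrX1 exprAC (prim_expr_order z_prim) expr1n subrr.
Qed.

(** The exponent [N - j] stands for [-j] modulo [N]. The size bound ensures that no index of the
    class with [k >= K] carries a nonzero coefficient. *)
Lemma root_of_unity_filter (F : fieldType) (N K j : nat) (z : F) (p : {poly F}) :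
  N.-primitive_root z -> (j < N)%N -> (size p <= K * N)%N ->
  \sum_(0 <= k < N) z ^+ (k * (N - j)) * p.[z ^+ k]
    = N%:R * \sum_(0 <= k < K) p`_(k * N + j).
Proof.
move=> z_prim ltjN szp.
under eq_bigr => k _ do rewrite (horner_coef_wide _ szp) mulr_sumr.
rewrite exchange_big /=.
transitivity (\sum_(m < K * N)
    p`_m * (if (N %| m + (N - j))%N then N%:R else 0)).
  apply: eq_bigr => m _; rewrite -(sum_prim_root_pow _ z_prim) mulr_sumr.
  by apply: eq_bigr => k _; rewrite mulrCA -exprM -exprD -mulnDr addnC.
rewrite -(big_mkord xpredT (fun m =>
  p`_m * (if (N %| m + (N - j))%N then N%:R else 0))).
rewrite big_nat_mul mulr_sumr; apply: eq_bigr => k _.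
rewrite -{1}[(k * N)%N]add0n big_addn mulSn addnK big_mkord.
rewrite (bigD1 (Ordinal ltjN)) //= big1 => [|i /eqP neq_ij]; last first.
  rewrite addnAC dvdn_addl ?dvdn_mull //; case: ifP => [|_]; last exact: mulr0.
  (* [i + (N - j)] lies strictly between [0] and [2 * N], so the only possible quotient is [1],
     which forces [i = j]. *)
  case/dvdnP => -[|[|q]] /=; have ltiN := ltn_ord i; rewrite ?mulSn; try lia.
  by move=> eqN; case: neq_ij; apply/val_inj => /=; lia.
rewrite addr0 (_ : (j + k * N + (N - j))%N = (k.+1 * N)%N) ?dvdn_mull //; last by lia.
by rewrite mulrC addnC.
Qed.

(** The first term bounds the roots outside the cube roots of unity, in three blocks of [M.-1]. The
    slack [3 * M] equals [N], so after division by [N] the class sum exceeds [1], not merely [0]. *)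
Lemma borwein_bound (M : nat) : (1 < M)%N ->
  (3 * (M.-1 * 3 ^ (M %/ 2)) + 3 * M < 2 * 3 ^ M)%N.
Proof.
(* With [M = 2h + b] and [t = 3 ^ h], the claim becomes quadratic in [t] and follows from
   [t >= 3h]. *)
move=> M_gt1; have [h h_gt0 [b b1 Mhb]] : exists2 h, (0 < h)%N &
    exists2 b, (b <= 1)%N & M = (h + h + b)%N.
  exists (M %/ 2)%N; first lia.
  by exists (M %% 2)%N; lia.
have -> : (M %/ 2 = h)%N by lia.
have t_ge : (3 * h <= 3 ^ h)%N.
  elim: h h_gt0 {Mhb} => // -[_ _ //|h IHh _].
  by have := IHh isT; rewrite (expnS 3 h.+1); lia.
rewrite Mhb !expnD; move: (3 ^ h)%N t_ge => t t_ge.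
case: b b1 {Mhb} => [|[|//]] _ /=; rewrite ?expn0 ?expn1; nia.
Qed.

Lemma borwein_prodE (n : nat) (w : algC) :
  (map_poly intr (borwein_prod n)).[w] = \prod_(0 <= i < n.+1)
    ((1 - w ^+ (3 * i + 1)) * (1 - w ^+ (3 * i + 2))).
Proof.
rewrite /borwein_prod rmorph_prod horner_prod; apply: eq_bigr => i _.
by rewrite rmorphM !rmorphB /= rmorph1 !map_polyXn !hornerE.
Qed.

(** Each single factor has leading coefficient [-1], but the factors come in pairs, so the signs
    cancel. *)
Lemma borwein_monic_size (n : nat) :
  borwein_prod n \is monic /\ size (borwein_prod n) = (n.+1 * (3 * n.+1)).+1.
Proof.
have facE i : (1 - 'X^(3 * i + 1)) * (1 - 'X^(3 * i + 2))
    = ('X^(3 * i + 1) - 1) * ('X^(3 * i + 2) - 1) :> {poly int}.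
  by rewrite -mulrNN !opprB.
have monicF k : (0 < k)%N -> ('X^k - 1 : {poly int}) \is monic.
  by move=> k_gt0; rewrite -[1]/(1%:P) monicXnsubC.
have sizeF k : (0 < k)%N -> size ('X^k - 1 : {poly int}) = k.+1.
  by move=> k_gt0; rewrite -[1]/(1%:P) size_XnsubC.
have fac_monic i : (1 - 'X^(3 * i + 1)) * (1 - 'X^(3 * i + 2) : {poly int})
    \is monic.
  by rewrite facE monicMl ?monicF // addnC.
have fac_size i : size ((1 - 'X^(3 * i + 1)) * (1 - 'X^(3 * i + 2) : {poly int}))
    = (6 * i + 4)%N.
  rewrite facE size_monicM ?monicF ?monic_neq0 ?monicF ?sizeF //; lia.
elim: n => [|n [mon sz]]; rewrite /borwein_prod.
  by rewrite big_nat1 fac_size; split; [exact: fac_monic|].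
rewrite big_nat_recr //= -/(borwein_prod n); split; first by rewrite monicMl.
rewrite size_monicM ?monic_neq0 // fac_size sz; lia.
Qed.

Section ResidueClass.

Variables (n : nat) (z : algC).
Let M := n.+1.
Let N := (3 * M)%N.
Hypothesis z_prim : N.-primitive_root z.

Let P (w : algC) : algC := (map_poly intr (borwein_prod n)).[w].

Lemma borwein_at_cube_root (c : nat) :
  P (z ^+ (c * M)) = if (3 %| c)%N then 0 else 3 ^+ M.
Proof.
have w3 : (z ^+ (c * M)) ^+ 3 = 1.
  by rewrite -exprM -mulnA (mulnC M) (mulnC c) exprM (prim_expr_order z_prim) expr1n.
have w3_prim : 1.-primitive_root ((z ^+ (c * M)) ^+ 3).
  by rewrite w3; apply/andP; split=> //; apply/forallP=> i; rewrite unity_rootE expr1n ord1 eqxx.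
rewrite /P borwein_prodE -{1}[n.+1]muln1 (borwein_values _ w3_prim) expr1.
rewrite cube_root_value // -(prim_order_dvd z_prim) dvdn_pmul2r //.
by case: ifP => // _; rewrite expr0n.
Qed.

(** Here [w ^+ 3] is not [1], so its order [e] is at least [2] and the exponent [f = M / e] is at
    most [M / 2]. *)
Lemma borwein_off_cube_root (k : nat) :
  ~~ (M %| k)%N -> `|P (z ^+ k)| <= 3 ^+ (M %/ 2).
Proof.
move=> ndvd; pose w := z ^+ k.
have w3M : (w ^+ 3) ^+ M = 1.
  by rewrite -exprM -/N -exprM mulnC exprM (prim_expr_order z_prim) expr1n.
have [e w3_prim /dvdnP[f Mfe]] := prim_order_exists (ltn0Sn n) w3M.
have e_gt1 : (1 < e)%N.
  rewrite ltn_neqAle (prim_order_gt0 w3_prim) andbT.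
  apply: contraNneq ndvd => e1; move: (prim_expr_order w3_prim).
  rewrite -e1 expr1 -exprM => /eqP.
  by rewrite -(prim_order_dvd z_prim) mulnC dvdn_pmul2l.
have le_f : (f <= M %/ 2)%N by rewrite leq_divRL // /M Mfe leq_mul2l e_gt1 orbT.
rewrite /P borwein_prodE Mfe (borwein_values _ w3_prim) cube_root_value; last first.
  by rewrite -exprM mulnC exprM (prim_expr_order w3_prim).
apply: (@le_trans _ _ (3 ^+ f)); last by rewrite ler_eXn2l // ltr1n.
rewrite normrX lerXn2r ?nnegrE //; case: ifP => _; first by rewrite normr0.
by rewrite normr_nat.
Qed.

(** The degree is exactly [M * N], so [M.+1] terms cover the whole class, one more than in the
    theorem. The bound [1] pays for the removal of one boundary coefficient. *)
Lemma borwein_class_gt1 (j : nat) : (1 < M)%N -> (j < N)%N -> (3 %| j)%N ->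
  1 < \sum_(0 <= k < M.+1) borwein_coef n (k * N + j).
Proof.
move=> M_gt1 ltjN dvd3j.
set S := \sum_(_ <= _ < _) _.
pose t k := z ^+ (k * (N - j)) * P (z ^+ k).
have filter : \sum_(0 <= k < N) t k = (N%:R * S)%:~R.
  rewrite (@root_of_unity_filter _ _ M.+1) //; last first.
    rewrite size_map_poly_id0; last first.
      by rewrite intr_eq0 lead_coef_eq0 monic_neq0 //; case: (borwein_monic_size n).
    by case: (borwein_monic_size n) => _ ->; rewrite mulSn /N /M; lia.
  rewrite rmorphM rmorph_nat rmorph_sum; congr (_ * _).
  by apply: eq_bigr => k _; rewrite coef_map.
have norm_z k : `|z ^+ k| = 1.
  apply/eqP; rewrite -(pexpr_eq1 (_ : 0 < N)%N) // -normrX exprAC.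
  by rewrite (prim_expr_order z_prim) expr1n normr1.
pose B : algC := (M.-1 * 3 ^ (M %/ 2))%:R.
(* Each block of [M] consecutive exponents has a single multiple of [M], its first element; the
   other [M.-1] terms fall under [borwein_off_cube_root]. *)
have block c : `|\sum_(c * M <= k < c.+1 * M) t k - t (c * M)%N| <= B.
  rewrite big_ltn; last by rewrite ltn_mul2r /=.
  rewrite [t _ + _]addrC addrK.
  apply: le_trans (ler_norm_sum _ _ _) _.
  apply: (@le_trans _ _ (\sum_((c * M).+1 <= k < c.+1 * M) 3 ^+ (M %/ 2))).
    apply: ler_sum_nat => k /andP[lo hi].
    rewrite normrM norm_z mul1r borwein_off_cube_root //.
    by apply/negP => /dvdnP[q kq]; move: lo hi; rewrite kq !ltn_mul2r /=; lia.
  rewrite sumr_const_nat -(mulr_natl (3 ^+ _)) -natrX -natrM /B.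
  by rewrite ler_nat leq_mul2r mulSn; apply/orP; right; lia.
have tE c : t (c * M)%N = if (3 %| c)%N then 0 else 3 ^+ M.
  rewrite /t borwein_at_cube_root; case: ifP => _; first exact: mulr0.
  (* The weight at a cube root of unity is [1] because [3] divides [N - j]; this is where the
     residue of [j] modulo [3] enters. *)
  rewrite (_ : z ^+ _ = 1) ?mul1r //; apply/eqP.
  rewrite -(prim_order_dvd z_prim) mulnAC dvdn_mul // dvdn_mull //.
  by rewrite dvdn_sub // dvdn_mulr.
have total : `|\sum_(0 <= k < N) t k - 2 * 3 ^+ M| <= 3 * B.
  have -> : \sum_(0 <= k < N) t k - 2 * 3 ^+ M
      = \sum_(0 <= c < 3) (\sum_(c * M <= k < c.+1 * M) t k - t (c * M)%N).
    rewrite sumrB -big_nat_mul; congr (_ - _).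
    by rewrite !big_nat_recr //= big_nil !tE /=; ring.
  apply: le_trans (ler_norm_sum _ _ _) _.
  apply: le_trans (ler_sum_nat (G := fun=> B) _) _ => [c _|]; first exact: block.
  by rewrite sumr_const_nat mulr_natl.
have int_total : `|N%:R * S - 2 * 3 ^+ M| <= (3 * (M.-1 * 3 ^ (M %/ 2)))%:R.
  rewrite -(ler_int algC) intr_norm rmorphB /= -filter !rmorphM rmorphXn /=.
  by rewrite !rmorph_nat natrM; exact: total.
have := borwein_bound M_gt1.
rewrite -(ltr_nat int) natrD (natrM _ 2) natrX => bnd.
rewrite -(ltr_pM2l (_ : (0 : int) < N%:R)) ?ltr0n // mulr1.
move: int_total; rewrite ler_norml => /andP[lo _].
rewrite -(ltrD2l (- (2 * 3 ^+ M))) [ltRHS]addrC; apply: lt_le_trans lo.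
by rewrite ltrNr opprD opprK ltrBrDr.
Qed.

End ResidueClass.

Theorem theorem1p5 (n N : nat) (hn : (0 < n)%N) (hN : N = (3 * n.+1)%N)
    (j : nat) (hjN : (j <= N)%N) (hj3 : j = 0 %[mod 3]) :
  0 < \sum_(0 <= k < n.+1) borwein_coef n (k * N + j).
Proof.
subst N; set N := (3 * n.+1)%N in hjN *.
have [z z_prim] : {z : algC | N.-primitive_root z} by exact: C_prim_root_exists.
have [mon sz] := borwein_monic_size n.
have dvd3j : (3 %| j)%N by rewrite /dvdn hj3.
case: (ltngtP j N) hjN => // [ltjN|->] _.
  have := borwein_class_gt1 z_prim hn ltjN dvd3j.
  rewrite big_nat_recr //=.
  (* The extra last term is the leading coefficient [1] when [j = 0], and lies beyond the degree
     otherwise. *)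
  have : borwein_coef n (n.+1 * N + j) <= 1.
    case: j {hj3 ltjN dvd3j} => [|j]; last first.
      by rewrite /borwein_coef nth_default // sz -/N addnS ltnS leq_addr.
    move/monicP: mon; rewrite lead_coefE sz /= -/N addn0.
    by rewrite /borwein_coef => ->.
  by move=> le1 gt1; rewrite -(ltrD2r 1) add0r; apply: lt_le_trans gt1 _; rewrite lerD2l.
(* For [j = N] the sum is that of the class of [0] without its first term, the constant coefficient
   [1]. *)
have := borwein_class_gt1 z_prim hn (ltn0Sn _ : (0 < N)%N) (dvdn0 3).
rewrite big_nat_recl //= mul0n.
have -> : borwein_coef n (0 + 0) = 1.
  rewrite addn0 /borwein_coef -horner_coef0 /borwein_prod horner_prod big1 // => i _.
  by rewrite !hornerE !addnS !expr0n /= !subr0 mulr1.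
rewrite -{1}[1]addr0 ltrD2l.
by under eq_bigr do rewrite addn0 mulSn addnC.
Qed.
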